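(* Let $\underline{T}:\mathbb{R}^{\mathcal{X}}\to\mathbb{R}^{\mathcal{X}}$ be a map that satisfies the coherence conditions C1, C2, C3 and the reachability condition R1 (listed in the context). Then the equation $\underline{h} = \mathbb{I}_{A^c} + \mathbb{I}_{A^c}\cdot\underline{T}\,\underline{h}$ has a unique solution $\underline{h}$ in $\mathbb{R}^{\mathcal{X}}$, and this solution is non-negative.
   Context: $\mathcal{X}$ is a non-empty finite set, $A$ is a non-empty strict subset of $\mathcal{X}$, and $A^c = \mathcal{X}\setminus A$. $\mathbb{R}^{\mathcal{X}}$ is the set of all maps from $\mathcal{X}$ to $\mathbb{R}$; inequalities between such maps are pointwise, a constant is identified with the corresponding constant map, and $\cdot$ denotes pointwise multiplication. For $B\subseteq\mathcal{X}$, $\mathbb{I}_B\in\mathbb{R}^{\mathcal{X}}$ is the indicator of $B$. $\mathbb{N}$ does not contain $0$, and $M^n$ denotes the $n$-fold composition of a map $M$ with itself. Coherence conditions for a (possibly non-linear) map $\underline{T}:\mathbb{R}^{\mathcal{X}}\to\mathbb{R}^{\mathcal{X}}$: C1: $\underline{T}(\alpha f)=\alpha\underline{T}f$ for all $f\in\mathbb{R}^{\mathcal{X}}$ and all real $\alpha\geq 0$; C2: $\underline{T}f+\underline{T}g\leq\underline{T}(f+g)$ for all $f,g\in\mathbb{R}^{\mathcal{X}}$; C3: $\min_{x\in\mathcal{X}}f(x)\leq\underline{T}f$ for all $f\in\mathbb{R}^{\mathcal{X}}$. Reachability condition R1: for all $x\in A^c$ there is some $n_x\in\mathbb{N}$ such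 that $[\underline{T}^{n_x}\mathbb{I}_A](x)>0$. *)

(* Defs.v *)
From mathcomp Require Import all_boot all_order all_algebra.
From mathcomp Require Import reals.

Set Implicit Arguments.
Unset Strict Implicit.
Unset Printing Implicit Defensive.

Import Order.TTheory GRing.Theory Num.Theory.
Local Open Scope ring_scope.

(* The space R^X of real-valued maps on the finite set X is {ffun X -> R}:
   its equality is extensional, and its + and * are the library's pointwise
   operations. *)

Section LowerTransitionOperators.
Variables (R : realType) (X : finType).
Implicit Types (T : {ffun X -> R} -> {ffun X -> R}) (f g h : {ffun X -> R}).
Implicit Types (A B : {set X}).

Definition indic B : {ffun X -> R} := [ffun x => (x \in B)%:R].

Definition nonneg_homogeneous T : Prop :=
  forall f (a : R), 0 <= a -> T [ffun x => a * f x] = [ffun x => a * T f x].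

Definition superadditive T : Prop :=
  forall f g x, (T f + T g) x <= T (f + g) x.

(* The seed f x is itself one of the values of f, so the iterated minimum is
   exactly the minimum of f over X; no junk default value enters. *)
Definition min_bounded T : Prop :=
  forall f x, \big[Num.min/f x]_(y : X) f y <= T f x.

Definition coherent T : Prop :=
  [/\ nonneg_homogeneous T, superadditive T & min_bounded T].

Definition reachable T A : Prop :=
  forall x, x \in ~: A -> exists2 n : nat, (0 < n)%N & 0 < iter n T (indic A) x.

Definition hitting_equation T A h : Prop :=
  h = indic (~: A) + indic (~: A) * T h.

End LowerTransitionOperators.

Arguments indic R {X} B.

(* Main.v *)
Require Import Defs.
From mathcomp Require Import classical_sets.
From mathcomp Require Import all_boot all_order all_algebra reals.
From mathcomp Require Import lra.

Import Order.TTheory GRing.Theory Num.Theory.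
Local Open Scope ring_scope.

(** With [G h = I_{A^c} + I_{A^c} T h], everything follows from one maximum
    principle: if [d <= I_{A^c} (c - T (- d))] with [c >= 0], then [d <= c K]
    for a [K] depending only on [T] and [A]. Indeed, if [m] bounds [d] from
    above, iterating gives [d <= n c + m (1 - T^n I_A)], and at a maximiser of
    [d] reachability turns this into a bound on [m]. For [c = 0] this is the
    comparison principle "[f <= G f] and [G g <= g] imply [f <= g]", hence
    uniqueness and non-negativity. For [c = 1] it bounds all [f] such that
    [f <= G f], so their pointwise supremum exists, and it solves the equation
    by Tarski's argument; no continuity of [T] is involved. *)

Section CoherentOperators.
Set Implicit Arguments.
Unset Strict Implicit.
Context {R : realType} {X : finType} {T : {ffun X -> R} -> {ffun X -> R}}.
Hypothesis hT : coherent T.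
Implicit Types (f g d h : {ffun X -> R}) (A : {set X}) (x y : X).

Lemma coherent_ge_cst f (a : R) : (forall y, a <= f y) -> forall x, a <= T f x.
Proof.
case: hT => _ _ hmin haf x; apply: le_trans (hmin f x).
by elim/big_ind: _ => // u v au av; rewrite le_min au.
Qed.

Lemma coherent0 x : T 0 x = 0.
Proof.
case: hT => hhom _ _; have := hhom 0 0 (lexx 0).
have -> : [ffun y => 0 * (0 : {ffun X -> R}) y] = 0.
  by apply/ffunP => y; rewrite !ffunE mul0r.
by move/ffunP/(_ x); rewrite ffunE mul0r.
Qed.

Lemma coherentD f g x : T f x + T g x <= T (f + g) x.
Proof. by case: hT => _ /(_ f g x); rewrite ffunE. Qed.

(** Superadditivity along [g = f + (g - f)]. This replaces linearity: differences of values of [T]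
    are controlled by the conjugate operator [f |-> - T (- f)]. *)
Lemma coherentB f g x : T f x - T g x <= - T (g - f) x.
Proof. by have := coherentD f (g - f) x; rewrite subrKC; lra. Qed.

Lemma coherent_le_conj f x : T f x <= - T (- f) x.
Proof. by have := coherentB f 0 x; rewrite coherent0 sub0r subr0. Qed.

Lemma coherent_mono f g : (forall y, f y <= g y) -> forall x, T f x <= T g x.
Proof.
move=> fg x; have h : 0 <= T (g - f) x.
  by apply: coherent_ge_cst => y; rewrite !ffunE subr_ge0.
by have := coherentB f g x; lra.
Qed.

Lemma coherent_le_cst f (a : R) : (forall y, f y <= a) -> forall x, T f x <= a.
Proof.
move=> fa x; have h : - a <= T (- f) x.
  by apply: coherent_ge_cst => y; rewrite !ffunE lerN2.
by have := coherent_le_conj f x; lra.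
Qed.

Lemma coherent_affine f (a b : R) x : 0 <= a ->
  a * T f x + b <= T [ffun y => a * f y + b] x.
Proof.
move=> a0; case: hT => hhom _ _.
have -> : [ffun y => a * f y + b] = [ffun y => a * f y] + [ffun=> b].
  by apply/ffunP => y; rewrite !ffunE.
apply: le_trans (coherentD _ _ x); rewrite hhom // ffunE lerD2l.
by apply: coherent_ge_cst => y; rewrite ffunE.
Qed.

Lemma iter_indic_le1 A n x : iter n T (indic R A) x <= 1.
Proof.
elim: n x => [|n IHn] x /=; first by rewrite ffunE; case: (x \in A).
exact: coherent_le_cst.
Qed.

Section MaximumPrinciple.
Variables (A : {set X}) (c : R) (d : {ffun X -> R}).
Hypothesis c0 : 0 <= c.
Hypothesis dA : forall x, x \in A -> d x <= 0.
Hypothesis dNA : forall x, x \notin A -> d x <= c - T (- d) x.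

Lemma subsolution_le_iter (m : R) n : 0 <= m -> (forall y, d y <= m) ->
  forall x, d x <= n%:R * c + m * (1 - iter n T (indic R A) x).
Proof.
move=> m0 dm; elim: n => [|n IHn] x.
  rewrite /= ffunE mul0r add0r; case: (boolP (x \in A)) => xA.
    by rewrite subrr mulr0 dA.
  by rewrite subr0 mulr1.
case: (boolP (x \in A)) => xA.
  apply: le_trans (dA xA) _; rewrite addr_ge0 ?mulr_ge0 ?ler0n //.
  by rewrite subr_ge0 iter_indic_le1.
apply: le_trans (dNA xA) _.
set v := iter n T (indic R A) in IHn *.
(* Negated, the induction hypothesis bounds [- d] below by an affine function of [v] with slope
   [m >= 0], through which [T] passes; [dNA] then adds one more [c]. *)
have h : m * T v x + (- (n%:R * c) - m) <= T (- d) x.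
  apply: le_trans (coherent_affine v _ x m0) _.
  by apply: coherent_mono => y; rewrite !ffunE; have := IHn y; lra.
by rewrite iterS -/v -natr1; lra.
Qed.

(** Where [d] attains the bound [m], the two [m] cancel in the iterated estimate, leaving
    [m * T^n I_A <= n * c]. *)
Lemma subsolution_le_max (m : R) n x : 0 <= m -> (forall y, d y <= m) ->
  d x = m -> 0 < iter n T (indic R A) x ->
  m <= c * (n%:R / iter n T (indic R A) x).
Proof.
move=> m0 dm dx t0; have := subsolution_le_iter n m0 dm x.
by rewrite dx mulrA ler_pdivlMr //; lra.
Qed.

End MaximumPrinciple.

Lemma maximum_principle A : reachable T A ->
  exists K : R, forall (c : R) d, 0 <= c ->
    (forall x, x \in A -> d x <= 0) ->
    (forall x, x \notin A -> d x <= c - T (- d) x) ->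
    forall x, d x <= c * K.
Proof.
move=> hR.
have /fin_all_exists[n hn] x :
    exists n : nat, x \notin A -> 0 < iter n T (indic R A) x.
  case: (boolP (x \in A)) => xA; first by exists 0%N.
  by have /hR[n _ hn] : x \in ~: A by [rewrite inE]; exists n.
pose k x : R := (n x)%:R / iter (n x) T (indic R A) x.
have k0 x : x \notin A -> 0 <= k x.
  by move=> xA; rewrite divr_ge0 ?ler0n // ltW ?hn.
(* The maximiser depends on [d], so [K] must dominate every [k x] off [A]; a sum of non-negative
   terms does. *)
exists (\sum_(x | x \notin A) k x) => c d c0 dA dNA x0.
have K0 : 0 <= \sum_(x | x \notin A) k x by apply: sumr_ge0.
case: (arg_maxP d (isT : xpredT x0)) => x _ dmax.
apply: le_trans (dmax x0 isT) _.
(* A positive maximum can only be attained off [A], where reachability applies. *)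
have [dx0|dx0] := leP (d x) 0; first by rewrite (le_trans dx0) ?mulr_ge0.
have xA : x \notin A by apply/negP => /dA; rewrite leNgt dx0.
apply: le_trans (_ : c * k x <= _).
  apply: (subsolution_le_max c0 dA dNA (ltW dx0)) => // [y|]; last exact: hn.
  exact: dmax.
by rewrite ler_wpM2l // (bigD1 x) //= lerDl sumr_ge0 // => y /andP[/k0].
Qed.

Definition hitting_step A h : {ffun X -> R} :=
  indic R (~: A) + indic R (~: A) * T h.

Lemma hitting_stepE A h x :
  hitting_step A h x = if x \in A then 0 else 1 + T h x.
Proof. by rewrite !ffunE inE; case: (x \in A); rewrite ?mul0r ?mul1r ?addr0. Qed.

Lemma hitting_step_mono A f g : (forall y, f y <= g y) ->
  forall x, hitting_step A f x <= hitting_step A g x.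
Proof.
move=> fg x; rewrite !hitting_stepE; case: ifP => // _.
by rewrite lerD2l coherent_mono.
Qed.

(** The maximum principle for [d = f - g] and [c = 0]: off [A] the constants 1 cancel, and
    [coherentB] bounds [T f - T g] by [- T (- d)]. *)
Lemma hitting_comparison A f g : reachable T A ->
  (forall x, f x <= hitting_step A f x) ->
  (forall x, hitting_step A g x <= g x) -> forall x, f x <= g x.
Proof.
move=> /maximum_principle[K hK] hf hg x; rewrite -subr_le0.
have := hK 0 (f - g) (lexx 0); rewrite mul0r.
move=> /(_ _ _ x); rewrite !ffunE; apply=> y yA; rewrite !ffunE.
  by have := hf y; have := hg y; rewrite !hitting_stepE yA; lra.
have := hf y; have := hg y; rewrite !hitting_stepE (negPf yA).
by have := coherentB f g y; rewrite opprB; lra.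
Qed.

(** The maximum principle for [d = f] and [c = 1], since [T f <= - T (- f)]. *)
Lemma hitting_subsolution_bounded A : reachable T A ->
  exists K : R, forall f, (forall x, f x <= hitting_step A f x) ->
    forall x, f x <= K.
Proof.
move=> /maximum_principle[K hK]; exists K => f hf x.
rewrite -[K]mul1r; apply: hK => // y yA; have := hf y;
  rewrite hitting_stepE; first by rewrite yA.
by rewrite (negPf yA); have := coherent_le_conj f y; lra.
Qed.

Lemma zero_hitting_subsolution A x :
  (0 : {ffun X -> R}) x <= hitting_step A 0 x.
Proof. by rewrite hitting_stepE coherent0 ffunE; case: ifP => // _; lra. Qed.

Lemma hitting_step_fixpoint A : reachable T A ->
  exists h, hitting_step A h = h.
Proof.
move=> /hitting_subsolution_bounded[K hK].
pose P f := forall x, f x <= hitting_step A f x.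
pose E x : set R := [set f x | f in [set f | P f]]%classic.
(* Needed for [sup] to be a genuine supremum: the zero map is a subsolution, and all subsolutions
   share the bound [K]. *)
have supE x : has_sup (E x).
  split; first by exists ((0 : {ffun X -> R}) x); exists 0 => // y;
    exact: zero_hitting_subsolution.
  by exists K => _ [f hf <-]; exact: hK.
pose h : {ffun X -> R} := [ffun x => sup (E x)].
have fh f x : P f -> f x <= h x.
  by move=> hf; rewrite ffunE; apply: ub_le_sup; [case: (supE x)|exists f].
(* By monotonicity [f <= G f <= G h] for each subsolution [f], so [G h] is an upper bound and
   [h <= G h]. *)
have hP : P h.
  move=> x; rewrite {1}ffunE; apply: ge_sup; first by case: (supE x).
  move=> _ [f hf <-]; apply: le_trans (hf x) _.
  by apply: hitting_step_mono => y; exact: fh.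
(* Conversely [G h] is itself a subsolution, hence lies below the supremum [h]. *)
exists h; apply/ffunP => x; apply/le_anti; rewrite hP andbT.
by apply: fh => y; apply: hitting_step_mono.
Qed.

End CoherentOperators.

Theorem proposition2 (R : realType) (X : finType) (hX : (0 < #|X|)%N)
    (A : {set X}) (hA : A != set0) (hAX : A \proper [set: X])
    (T : {ffun X -> R} -> {ffun X -> R}) (hT : coherent T)
    (hR : reachable T A) :
  (exists! h : {ffun X -> R}, hitting_equation T A h) /\
  (forall h : {ffun X -> R}, hitting_equation T A h -> forall x, 0 <= h x).
Proof.
have solE h : hitting_equation T A h -> hitting_step A (T := T) h = h by [].
have le_sol f g : hitting_equation T A f -> hitting_equation T A g ->
    forall x, f x <= g x.
  by move=> /solE hf /solE hg; apply: (hitting_comparison hT hR) => x;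
    rewrite ?hf ?hg.
split.
  have [h hh] := hitting_step_fixpoint hT hR; have eh : hitting_equation T A h by [].
  exists h; split => // g eg; apply/ffunP => x.
  by apply/le_anti; rewrite !le_sol.
move=> h /solE hh x.
(* Non-negativity is comparison with the zero subsolution. *)
have := @hitting_comparison _ _ _ hT A 0 h hR (zero_hitting_subsolution hT A).
by move=> /(_ _ x); rewrite ffunE; apply=> y; rewrite hh.
Qed.
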